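(* Let $\Gamma$ be a countably infinite discrete amenable group acting continuously on a compact metric space $X$. Suppose that the topological multiplicity $\mathrm{Mult}(X,\Gamma)$ is finite. Then $h_{top}(X,\Gamma)=0$.
   Context: A family $\mathcal F\subset C(X)$ is called generating if the linear span of $\{f\circ g: f\in\mathcal F,\ g\in\Gamma\}$ is dense in $C(X)$ (uniform norm), where $g\in\Gamma$ is regarded as the homeomorphism $x\mapsto gx$ of $X$. The topological multiplicity $\mathrm{Mult}(X,\Gamma)$ is the minimal cardinality of a generating family. $h_{top}(X,\Gamma)$ is the topological entropy of the action: $h_{top}(X,\Gamma)=\sup_{\alpha}\lim_{n}\frac{1}{|F_n|}\log N(\bigvee_{g\in F_n}g^{-1}\alpha)$, where $\alpha$ ranges over finite open covers of $X$, $N(\cdot)$ is the minimal cardinality of a subcover, and $\{F_n\}$ is any Følner sequence of $\Gamma$ (non-empty finite sets with $|F_n\Delta gF_n|/|F_n|\to0$ for every $g\in\Gamma$). *)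

(* Defs.v *)
From HB Require Import structures.
From mathcomp Require Import all_boot all_order all_algebra finmap.
From mathcomp Require Import all_classical all_reals all_analysis.

Set Implicit Arguments.
Unset Strict Implicit.
Unset Printing Implicit Defensive.

Import Order.TTheory GRing.Theory Num.Theory.
Import numFieldTopology.Exports numFieldNormedType.Exports.

Local Open Scope classical_set_scope.
Local Open Scope ring_scope.

Definition ltranslate (G : groupType) (g : G) (A : {fset G}) : {fset G} :=
  [fset (g * x)%g | x in A]%fset.

Definition fsymdiff (G : groupType) (A B : {fset G}) : {fset G} :=
  ((A `\` B) `|` (B `\` A))%fset.

Definition folner_sequence (R : realType) (G : groupType)
    (F : nat -> {fset G}) : Prop :=
  (forall n, F n != fset0) /\
  (forall g : G,
     (#|` fsymdiff (F n) (ltranslate g (F n))|%:R / #|` F n|%:R : R)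
       @[n --> \oo] --> (0 : R)).

(* Amenability of a countable discrete group, in Folner's form. *)
Definition amenable (R : realType) (G : groupType) : Prop :=
  exists F : nat -> {fset G}, folner_sequence R F.

(* For a discrete group, joint continuity of the action is continuity of each
   [act g]. *)
Definition continuous_action (G : groupType) (X : topologicalType)
    (act : G -> X -> X) : Prop :=
  [/\ forall x, act 1%g x = x,
      forall g h x, act (g * h)%g x = act g (act h x) &
      forall g, continuous (act g)].

Definition linear_span (R : realType) (V : lmodType R) (S : set V) : set V :=
  [set v | exists (n : nat) (c : 'I_n -> R) (s : 'I_n -> V),
     (forall i, S (s i)) /\ v = \sum_(i < n) c i *: s i].

(* C(X) is the set of continuous real functions on X; on it the topology of
   [{uniform X -> R}] is that of the uniform norm. *)
Definition generating (R : realType) (G : groupType) (X : topologicalType)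
    (act : G -> X -> X) (F : set (X -> R)) : Prop :=
  F `<=` [set f | continuous f] /\
  [set f : {uniform X -> R} | continuous (f : X -> R)] `<=`
    closure (linear_span [set f \o act g | f in F & g in [set: G]]
             : set {uniform X -> R}).

(* The minimal cardinality of a generating family, all infinite cardinals being
   identified with +oo. *)
Definition topological_multiplicity (R : realType) (G : groupType)
    (X : topologicalType) (act : G -> X -> X) : \bar R :=
  ereal_inf [set n%:R%:E | n in
    [set n : nat | exists2 F : set (X -> R),
       generating act F & (F #= `I_n)%card]].

Definition covers (X : Type) (A : set (set X)) : Prop :=
  \bigcup_(U in A) U = [set: X].

Definition finite_open_cover (X : topologicalType) (A : set (set X)) : Prop :=
  [/\ finite_set A, A `<=` open & covers A].

(* The join of the covers g^{-1} A, for g in F: its members are the sets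
   \bigcap_(g in F) g^{-1} (U g) with U g in A for every g in F. *)
Definition join_cover (G : groupType) (X : Type) (act : G -> X -> X)
    (F : {fset G}) (A : set (set X)) : set (set X) :=
  [set \bigcap_(g in [set` F]) (act g @^-1` U g) | U in
    [set U : G -> set X | forall g, g \in F -> A (U g)]].

(* An infimum of natural numbers, hence a minimum whenever A is a finite cover. *)
Definition min_subcover (R : realType) (X : Type) (A : set (set X)) : R :=
  inf [set n%:R | n in
    [set n : nat | exists B : set (set X),
       [/\ B `<=` A, covers B & (B #= `I_n)%card]]].

(* The common limit of log N / |F_n| along all Folner sequences. The junk value
   +oo, taken when there is no common limit, cannot be mistaken for a finite
   entropy, unlike the default value 0 of [lim]. *)
Definition cover_entropy (R : realType) (G : groupType) (X : Type)
    (act : G -> X -> X) (A : set (set X)) : \bar R :=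
  xget +oo%E [set l : \bar R | forall F : nat -> {fset G},
    folner_sequence R F ->
    (ln (min_subcover R (join_cover act (F n) A)) / #|` F n|%:R)%:E
      @[n --> \oo] --> l].

Definition topological_entropy (R : realType) (G : groupType)
    (X : topologicalType) (act : G -> X -> X) : \bar R :=
  ereal_sup [set cover_entropy R act A | A in @finite_open_cover X].

Arguments topological_multiplicity R {G X} act.
Arguments topological_entropy R {G X} act.

(* Main.v *)
Require Import Defs.
From HB Require Import structures.
From mathcomp Require Import all_boot all_order all_algebra finmap.
From mathcomp Require Import all_classical all_reals all_analysis.
From mathcomp Require Import ring lra zify.

Set Implicit Arguments.
Unset Strict Implicit.
Unset Printing Implicit Defensive.

Import Order.TTheory GRing.Theory Num.Theory.
Import numFieldTopology.Exports numFieldNormedType.Exports.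

(* By compactness the entropy of a finite open cover is controlled by finitely
   many continuous bumps phi with values in [-1, 1], a point being labelled at
   g in F_n where phi (g x) is 1 or -1. A halving argument bounds the number of
   labellings needed to cover X by exp (e |F_n|), with e small as soon as every
   J in F_n over which all sign patterns of phi occur has small density.

   Such a J cannot have positive density when m functions generate. For k in a
   finite set K, the function phi * (phi o k) is within 1/2 of a combination of
   finitely many translates of the generators. Hence, on points realising all
   the sign patterns over J, the Walsh functions of the pairs {a, k a} in J are
   within 1/2 of a space of dimension about m |F_n|. They are orthogonal, so
   there are at most O(m |F_n|) of them. But G is infinite: taking K = L L^-1
   with L large, double counting in the translates of L gives arbitrarily many
   times |F_n| such pairs in a set J of fixed density. *)

(** * Orthogonal families near a subspace *)

Local Open Scope ring_scope.

(** Gram-Schmidt, one row at a time. A row that depends on the earlier ones adds nothing to [Q],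
    whence [r <= D] only. *)
Lemma orthonormal_rows_factorization (R : rcfType) (D N : nat)
    (A : 'M[R]_(D, N)) :
  exists r (C : 'M[R]_(D, r)) (Q : 'M[R]_(r, N)),
    [/\ (r <= D)%N, Q *m Q^T = 1%:M & A = C *m Q].
Proof.
elim: D A => [A|D IH]; first by exists 0%N, 0, 0; rewrite !(flatmx0 _).
rewrite -[D.+1]/(1 + D)%N => A.
have [r [C [Q [rD QQ AQ]]]] := IH (dsubmx A).
(* [u] is the component of the new row orthogonal to the rows of [Q]. *)
pose v := usubmx A; pose u := v - v *m Q^T *m Q.
have uQ : u *m Q^T = 0 by rewrite mulmxBl -!mulmxA QQ mulmx1 subrr.
have Qu : Q *m u^T = 0 by rewrite -[LHS]trmxK trmx_mul trmxK uQ trmx0.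
have vE : v = u + v *m Q^T *m Q by rewrite subrK.
clearbody u.
have uu : (u *m u^T) 0 0 = \sum_j u 0 j ^+ 2.
  by rewrite mxE; apply: eq_bigr => j _; rewrite mxE expr2.
have [u0|u0] := eqVneq u 0.
  exists r, (col_mx (v *m Q^T) C), Q; split; [exact: leqW| by [] |].
  by rewrite mul_col_mx -AQ {1}[v *m _ *m _]((_ : _ = v)) ?vsubmxK// {2}vE u0 add0r.
have s0 : 0 < (u *m u^T) 0 0.
  rewrite lt0r uu sumr_ge0 ?andbT; last by move=> j _; apply: sqr_ge0.
  apply: contra_neq u0 => s0; apply/rowP => j; rewrite mxE.
  apply/eqP; rewrite -sqrf_eq0.
  by move/eqP: s0; rewrite psumr_eq0 => [/allP/(_ j (mem_index_enum _))//|i _]; apply: sqr_ge0.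
pose s := Num.sqrt ((u *m u^T) 0 0).
have sn0 : s != 0 by rewrite gt_eqF ?sqrtr_gt0.
exists (1 + r)%N, (block_mx s%:M (v *m Q^T) 0 C), (col_mx (s^-1 *: u) Q); split.
- by rewrite leq_add2l.
- rewrite tr_col_mx mul_col_row linearZ /= -scalemxAl -scalemxAr scalerA.
  rewrite -scalemxAl -scalemxAr uQ Qu !scaler0 QQ.
  rewrite [u *m u^T]mx11_scalar scale_scalar_mx.
  rewrite -invfM -expr2 sqr_sqrtr ?ltW// mulVf ?gt_eqF//.
  by rewrite -scalar_mx_block.
- rewrite mul_block_col mul0mx add0r -AQ mul_scalar_mx scalerA divff// scale1r.
  by rewrite -vE vsubmxK.
Qed.

Section ApproximateRank.
Variable R : rcfType.
Implicit Types M N D r : nat.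

(** The squared Frobenius norm. *)
Definition sqnorm M N (A : 'M[R]_(M, N)) : R := \tr (A *m A^T).

Lemma sqnormE M N (A : 'M[R]_(M, N)) : sqnorm A = \sum_i \sum_j A i j ^+ 2.
Proof.
by apply: eq_bigr => i _; rewrite mxE; apply: eq_bigr => j _; rewrite mxE expr2.
Qed.

Lemma sqnorm_ge0 M N (A : 'M[R]_(M, N)) : 0 <= sqnorm A.
Proof.
by rewrite sqnormE; do 2![apply: sumr_ge0 => ? _]; apply: sqr_ge0.
Qed.

Lemma sqnormB M N (A B : 'M[R]_(M, N)) :
  sqnorm (A - B) = sqnorm A - \tr (A *m B^T) *+ 2 + sqnorm B.
Proof.
rewrite /sqnorm linearB /= mulmxBl !mulmxBr !linearB /=.
have -> : \tr (B *m A^T) = \tr (A *m B^T) by rewrite -mxtrace_tr trmx_mul trmxK.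
by ring.
Qed.

(** With [P = w Q^T], the rows of [P^T w] are [c] times the projections of the rows of [Q] to the
    row space of [w]. The squared distance from [c Q] to [P^T w] is [c (c r - |P|^2)], and it is
    nonnegative. *)
Lemma bessel M N r c (w : 'M[R]_(M, N)) (Q : 'M[R]_(r, N)) : 0 < c ->
  w *m w^T = c%:M -> Q *m Q^T = 1%:M -> sqnorm (w *m Q^T) <= c * r%:R.
Proof.
move=> c0 ww QQ; move PE : (w *m Q^T) => P.
have := sqnorm_ge0 (c *: Q - P^T *m w); rewrite sqnormB.
have -> : sqnorm (c *: Q) = c * (c * r%:R).
  by rewrite /sqnorm linearZ/= -scalemxAl -scalemxAr QQ !mxtraceZ mxtrace1.
have -> : sqnorm (P^T *m w) = c * sqnorm P.
  rewrite /sqnorm trmx_mul trmxK mulmxA -(mulmxA P^T) ww -mulmxA mul_scalar_mx.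
  by rewrite -scalemxAr mxtraceZ mxtrace_mulC.
have -> : \tr (c *: Q *m (P^T *m w)^T) = c * sqnorm P.
  rewrite trmx_mul trmxK -scalemxAl mxtraceZ mulmxA /sqnorm; congr (_ * _).
  by rewrite mxtrace_mulC -PE trmx_mul trmxK mulmxA.
rewrite (_ : _ + _ = c * (c * r%:R - sqnorm P)); last by ring.
by rewrite pmulr_rge0// subr_ge0.
Qed.

Lemma approximate_rank M N D c (w : 'M[R]_(M, N)) (A : 'M[R]_(D, N))
    (C : 'M[R]_(M, D)) : 0 < c -> w *m w^T = c%:M ->
  c * (M%:R - D%:R) <= sqnorm (w - C *m A).
Proof.
move=> c0 ww; have [r [B [Q [rD QQ ->]]]] := orthonormal_rows_factorization A.
rewrite mulmxA; set K := C *m B.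
(* Pythagoras: the part of [w] orthogonal to the rows of [Q], plus the error inside their span. *)
have -> : sqnorm (w - K *m Q)
    = sqnorm w - sqnorm (w *m Q^T) + sqnorm (w *m Q^T - K).
  rewrite !sqnormB; have -> : sqnorm (K *m Q) = sqnorm K.
    by rewrite /sqnorm trmx_mul mulmxA -(mulmxA K) QQ mulmx1.
  by rewrite trmx_mul mulmxA; ring.
have -> : sqnorm w = c * M%:R by rewrite /sqnorm ww mxtrace_scalar mulr_natr.
have /le_trans : c * (M%:R - D%:R) <= c * M%:R - sqnorm (w *m Q^T).
  rewrite mulrBr lerB// (le_trans (bessel c0 ww QQ))//.
  by rewrite ler_pM2l// ler_nat.
by apply; rewrite lerDl sqnorm_ge0.
Qed.

End ApproximateRank.

(** Entrywise errors of 1/2 give a squared norm of at most [|T| |I| / 4], while [approximate_rank]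
    with [c = |I|] makes it at least [|I| (|T| - |D|)]. *)
Lemma approximate_rank_fin (R : rcfType) (T D I : finType) (w : T -> I -> R)
    (A : D -> I -> R) (C : T -> D -> R) :
  (0 < #|I|)%N ->
  (forall t t', \sum_i w t i * w t' i = (t == t')%:R * #|I|%:R) ->
  (forall t i, `|w t i - \sum_d C t d * A d i| <= 2^-1) ->
  (3 * #|T| <= 4 * #|D|)%N.
Proof.
move=> I0 ww wA.
pose W := \matrix_(a < #|T|, b < #|I|) w (enum_val a) (enum_val b).
pose AA := \matrix_(a < #|D|, b < #|I|) A (enum_val a) (enum_val b).
pose CC := \matrix_(a < #|T|, b < #|D|) C (enum_val a) (enum_val b).
have I0' : 0 < #|I|%:R :> R by rewrite ltr0n.
have reindexI (J : finType) (F : J -> R) : \sum_(a < #|J|) F (enum_val a) = \sum_j F j.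
  by rewrite [RHS](reindex (fun a : 'I_#|J| => enum_val a))//; apply: onW_bij; apply: enum_val_bij.
have WW : W *m W^T = #|I|%:R%:M.
  apply/matrixP => a b; rewrite !mxE.
  under eq_bigr do rewrite !mxE.
  rewrite (reindexI _ (fun i => w (enum_val a) i * w (enum_val b) i)) ww.
  by rewrite (inj_eq enum_val_inj) mulr_natl.
have := approximate_rank AA CC I0' WW.
have : sqnorm (W - CC *m AA) <= \sum_(a < #|T|) \sum_(b < #|I|) (2^-1) ^+ 2.
  rewrite sqnormE; apply: ler_sum => a _; apply: ler_sum => b _.
  rewrite -real_normK ?num_real// lerXn2r ?nnegrE ?invr_ge0//.
  rewrite !mxE; under eq_bigr do rewrite !mxE.
  by rewrite (reindexI _ (fun d => C (enum_val a) d * A d (enum_val b))).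
rewrite !sumr_const !card_ord => h1 /le_trans/(_ h1).
rewrite -mulrnA -[leRHS]mulr_natl natrM -mulrA ler_pM2l// -(ler_nat R) !natrM.
lra.
Qed.

(** * Walsh functions on the subsets of a finite set *)

Section Walsh.
Variables (R : numDomainType) (J : finType).
Implicit Types S T : {set J}.

Definition walsh T S : R := \prod_(a in T) (-1) ^+ (a \in S).

Lemma walsh2 a b S : a != b ->
  walsh [set a; b]%SET S = (-1) ^+ (a \in S) * (-1) ^+ (b \in S).
Proof. by move=> ab; rewrite /walsh big_setU1 ?big_set1 ?inE. Qed.

(** For [T != T'], toggling a point that lies in exactly one of them permutes the sets [S] and
    negates every summand, so the sum equals its opposite. *)
Lemma walsh_orthogonal T T' :
  \sum_S walsh T S * walsh T' S = (T == T')%:R * #|{: {set J}}|%:R.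
Proof.
have [<-|/eqP TT'] := eqVneq T T'.
  rewrite mul1r -sum1_card natr_sum; apply: eq_bigr => S _.
  by rewrite -big_split big1 //= => a _; rewrite -expr2 sqrr_sign.
have [a aT] : exists a, (a \in T) != (a \in T').
  apply/existsP; apply: contra_notT TT' => /existsPn h.
  by apply/setP => a; apply/eqP/negbNE.
pose f S := [set b | (b \in S) (+) (b == a)]%SET.
have fK : involutive f.
  by move=> S; apply/setP => b; rewrite !inE -addbA addbb addbF.
have wf U S : walsh U (f S) = walsh U S * (-1) ^+ (a \in U).
  rewrite /walsh; under eq_bigr do rewrite inE signr_addb.
  rewrite big_split/=; congr (_ * _).
  have [aU|aU] := boolP (a \in U).
    rewrite (bigD1 a)//= eqxx big1 ?mulr1// => b /andP[_ /negbTE->].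
    by rewrite expr0.
  rewrite big1// => b bU; rewrite (_ : b == a = false) ?expr0//.
  by apply: contraNF aU => /eqP <-.
set s := \sum_S _.
have : s = - s.
  rewrite {1}/s (reindex_inj (inv_inj fK)) /= -sumrN.
  apply: eq_bigr => S _; rewrite !wf mulrACA -signr_addb.
  by rewrite addbC -negb_eqb eq_sym aT expr1 mulrN1.
by move/eqP; rewrite -addr_eq0 -mulr2n mulrn_eq0 mul0r => /eqP.
Qed.

End Walsh.

(** * Counting pairs with a common neighbour *)

Local Open Scope nat_scope.

Definition common_neighbour_pairs (J Y : finType) (r : J -> Y -> bool) :=
  [set p : J * J | (p.1 != p.2) && [exists y, r p.1 y && r p.2 y]]%SET.

(* Double counting of the triples (a, b, y) with y a common neighbour of a and
   b; the free parameter q linearises the quadratic lower bound. *)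
Lemma card_common_neighbour_pairs (J Y : finType) (r : J -> Y -> bool) l q :
  (forall a, #|[set y | r a y]%SET| = l) ->
  2 * q * (l * #|J|) <=
    l * #|J| + l * #|common_neighbour_pairs r| + q ^ 2 * #|Y|.
Proof.
move=> rl; pose t y := \sum_a r a y.
have sumr a : \sum_y r a y = l.
  rewrite -(rl a) -sum1dep_card [RHS]big_mkcond.
  by apply: eq_bigr => y _; case: (r a y).
have sumt : \sum_y t y = l * #|J|.
  by rewrite exchange_big /= (eq_bigr (fun=> l)) ?sum_nat_const 1?mulnC// => a _.
(* [t y ^ 2] counts ordered pairs of neighbours of [y]. A pair has at most [l] common neighbours,
   and exactly [l] on the diagonal. *)
have sumt2 : \sum_y t y ^ 2 <= l * #|J| + l * #|common_neighbour_pairs r|.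
  have -> : \sum_y t y ^ 2 = \sum_(p : J * J) \sum_y r p.1 y * r p.2 y.
    rewrite exchange_big; apply: eq_bigr => y _.
    by rewrite -mulnn big_distrlr pair_big.
  have -> : l * #|J| = \sum_(p : J * J) (p.1 == p.2) * l.
    rewrite -(pair_big predT predT (fun a b => (a == b) * l))/= mulnC.
    rewrite -sum_nat_const; apply: eq_bigr => a _.
    rewrite (bigD1 a)//= eqxx mul1n big1 ?addn0// => b ba.
    by rewrite eq_sym (negbTE ba).
  rewrite mulnC -sum_nat_cond_const [X in _ + X]big_mkcond -big_split/=.
  apply: leq_sum => -[a b] _ /=.
  have h : \sum_y r a y * r b y <= l.
    by rewrite -(sumr a); apply: leq_sum => y _; rewrite -[leqRHS]muln1 leq_mul2l leq_b1 orbT.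
  have [->|ab] := eqVneq a b.
    by rewrite mul1n addn0 -(sumr b); apply: leq_sum => y _; case: (r b y).
  rewrite mul0n add0n; case: ifPn => // /existsPn h0.
  by rewrite big1// => y _; rewrite mulnb (negbTE (h0 y)).
apply: (@leq_trans (\sum_y (t y ^ 2 + q ^ 2))).
  rewrite -sumt big_distrr/=; apply: leq_sum => y _.
  by rewrite -mulnA addnC; apply: nat_Cauchy.
by rewrite big_split/= sum_nat_const (mulnC #|_|) leq_add2r.
Qed.

(** * Partially defined labels *)

(** The number of subsets of size strictly below [k] in an [n]-set. The strict bound gives 0 at
    [k = 0], where the halving recursion starts. *)
Definition binsum n k := \sum_(i < k) 'C(n, i).

Lemma binsumSS n k : binsum n.+1 k.+1 = binsum n k.+1 + binsum n k.
Proof.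
rewrite /binsum !big_ord_recl !bin0 -addnA; congr (_ + _).
by rewrite -big_split; apply: eq_bigr => i _; rewrite binS.
Qed.

Lemma card_small_sets (Z : finType) D :
  #|[set J : {set Z} | #|J| <= D]%SET| = binsum #|Z| D.+1.
Proof.
rewrite -sum1dep_card (partition_big (fun J : {set Z} => inord #|J| : 'I_D.+1) predT)//=.
apply: eq_bigr => i _; rewrite -card_draws -sum1dep_card.
apply: eq_bigl => J.
apply/andP/eqP => [[JD /eqP <-]|Ji]; first by rewrite inordK.
by rewrite Ji -ltnS ltn_ord; split=> //; apply/eqP/val_inj; rewrite /= inordK ?ltn_ord.
Qed.

Section PartialLabels.
Variables (X : Type) (Z : finType) (label : X -> Z -> option bool).
Implicit Types (V : X -> Prop) (J S : {set Z}).

(** Shattering in the sense of Vapnik and Chervonenkis, where [None] realises neither label. The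
    empty set is shattered as soon as [V] is inhabited. *)
Definition shatters V J := forall S,
  exists2 x, V x & forall z, z \in J -> label x z = Some (z \in S).

Definition shattered V : {set {set Z}} := [set J | `[< shatters V J >]]%SET.

Definition restrict_label V z b x := V x /\ label x z = Some b.

(** A set shattered by either half avoids [z] and is shattered by [V]. If both halves shatter [J],
    then [V] also shatters [J] with [z] added, which makes up for counting [J] twice. *)
Lemma card_shattered V z :
  #|shattered (restrict_label V z false)|
    + #|shattered (restrict_label V z true)| <= #|shattered V|.
Proof.
set V_ := restrict_label V z.
have notin b J : shatters (V_ b) J -> z \notin J.
  move=> sJ; apply/negP => zJ.
  have [x [_ xb] /(_ z zJ)] := sJ (if b then finset.set0 else [set z]%SET).
  by rewrite xb; case: (b); rewrite inE ?eqxx.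
have sub b J : shatters (V_ b) J -> shatters V J.
  by move=> sJ S; have [x [Vx _] xS] := sJ S; exists x.
rewrite -cardsUI.
pose add J := (z |: J)%SET.
have addK : {in shattered (V_ false) :&: shattered (V_ true) &, injective add}%SET.
  move=> J J1 /setIP[+ _] /setIP[+ _].
  rewrite !inE => sJ sJ1.
  by move/(congr1 (fun A => A :\ z)%SET); rewrite /add !finset.setU1K ?(notin _ _ sJ) ?(notin _ _ sJ1).
rewrite -(card_in_imset addK) -cardsUI.
rewrite [X in _ + X](_ : _ = 0) ?addn0; last first.
  apply/eqP; rewrite cards_eq0; apply/eqP/setP => J; rewrite !inE.
  apply/negbTE/negP => /andP[/orP h /imsetP[J' _ JE]].
  have : z \notin J by case: h => /asboolP; apply: notin.
  by rewrite JE !inE eqxx.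
apply: subset_leq_card; apply/fintype.subsetP => J; rewrite !inE.
case/orP => [/orP[]|/imsetP[J' + ->]]; [by move=> /asboolP; apply: sub..|].
rewrite !inE => /andP[/asboolP s0 /asboolP s1] S.
have [x [Vx xz] xS] : exists2 x, V_ (z \in S) x &
    forall y, y \in J' -> label x y = Some (y \in S).
  by case: (z \in S); [apply: s1|apply: s0].
by exists x => // y; rewrite !inE => /orP[/eqP ->//|]; apply: xS.
Qed.

(* The halving algorithm: predict at each coordinate the label leaving the
   larger number of shattered sets, so that every wrong prediction halves that
   number; the labels of a point are determined by its set of mistakes. *)
Lemma halving_cover (l : seq Z) V k : #|shattered V| < 2 ^ k ->
  exists2 s : seq {ffun Z -> bool}, size s <= binsum (size l) k &
    forall x, V x -> exists2 f, f \in s &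
      forall z b, z \in l -> label x z = Some b -> f z = b.
Proof.
(* For [k = 0] not even the empty set is shattered, so [V] is empty. *)
elim: l V k => [|z l IH] V k Vk; (case: k Vk => [|k] Vk;
  first by exists [::] => // x Vx; move: Vk; rewrite ltnNge card_gt0 => /negP[];
   apply/set0Pn; exists finset.set0; rewrite inE; apply/asboolP => S; exists x => // ?; rewrite inE).
  exists [:: [ffun=> false]] => [|x _]; first by rewrite /binsum big_ord_recl.
  by exists [ffun=> false]; rewrite ?inE.
(* [p] is the prediction at [z]. A point with no label at [z] counts as correctly predicted and
   stays with [s1]. *)
have [p pV] : exists p, #|shattered (restrict_label V z (~~ p))| < 2 ^ k.
  have := leq_ltn_trans (card_shattered V z) Vk.
  rewrite expnS mul2n -addnn => h.
  have [h1|h1] := ltnP #|shattered (restrict_label V z true)| (2 ^ k).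
    by exists false.
  by exists true; rewrite ltnNge; apply: contraTN h => h0; rewrite -leqNgt leq_add.
have [s1 s1k s1V] := IH _ _ Vk; have [s2 s2k s2V] := IH _ _ pV.
pose upd b (f : {ffun Z -> bool}) := [ffun y => if y == z then b else f y].
exists (map (upd p) s1 ++ map (upd (~~ p)) s2).
  by rewrite size_cat !size_map binsumSS leq_add.
move=> x Vx; have [xp|xp] := eqVneq (label x z) (Some (~~ p)).
  have [f fs fx] := s2V x (conj Vx xp).
  exists (upd (~~ p) f); first by rewrite mem_cat (map_f _ fs) orbT.
  move=> y b; rewrite inE ffunE; case: eqP => [-> _|_ /=]; last exact: fx.
  by rewrite xp => -[].
have [f fs fx] := s1V x Vx.
exists (upd p f); first by rewrite mem_cat (map_f _ fs).
move=> y b; rewrite inE ffunE; case: eqP => [-> _ xb|_ /=]; last exact: fx.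
by move: xp; rewrite xb; case: (p); case: (b).
Qed.

End PartialLabels.

(** * Exponential bounds on the number of labellings *)

Local Open Scope ring_scope.

(** A Chernoff bound: [t ^+ D <= t ^+ i] for [i <= D], so the left side is at most a partial sum of
    the binomial expansion of the right side. *)
Lemma binsum_le (R : numDomainType) (t : R) N D : 0 <= t <= 1 ->
  (binsum N D.+1)%:R * t ^+ D <= (1 + t) ^+ N.
Proof.
move=> /andP[t0 t1]; elim: N D => [|N IH] D.
  rewrite /binsum big_ord_recl big1 ?addn0 ?bin0 ?expr0 ?mul1r ?exprn_ile1//.
case: D => [|D].
  by rewrite /binsum big_ord1 bin0 mul1r expr0 exprn_ege1// lerDl.
rewrite binsumSS natrD mulrDl [leRHS]exprS mulrDl mul1r lerD//.
by rewrite exprS mulrCA ler_wpM2l.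
Qed.

Lemma binsum_expR (R : realType) (e : R) : 0 < e ->
  exists2 d : R, 0 < d & forall N D, D%:R <= d * N%:R ->
    (binsum N D.+1)%:R <= expR (e * N%:R).
Proof.
move=> e0; pose t : R := Num.min 1 (e / 2).
have t0 : 0 < t by rewrite lt_min ltr01 divr_gt0.
have t1 : t <= 1 by rewrite ge_min lexx.
have te : t <= e / 2 by rewrite ge_min lexx orbT.
have L0 : 0 <= - ln t by rewrite oppr_ge0 ln_le0.
(* Half of [e] pays for [(1 + t) ^+ N], the other half for [t ^- D]. The denominator is [1 - ln t]
   because [- ln t] vanishes at [t = 1]. *)
exists (e / 2 / (1 - ln t)); first by rewrite !divr_gt0// ltr_wpDr.
move=> N D DN; have := @binsum_le _ t N D; rewrite ltW// t1 => /(_ isT).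
rewrite -ler_pdivlMr ?exprn_gt0// => /le_trans; apply.
have -> : (t ^+ D)^-1 = expR (- ln t * D%:R).
  by rewrite mulNr expRN mulrC expRM_natl lnK.
have h : (1 + t) ^+ N <= expR (t * N%:R).
  by rewrite mulrC expRM_natl lerXn2r ?nnegrE ?expR_ge0 ?expR_ge1Dx// addr_ge0// ltW.
apply: le_trans (ler_wpM2r (expR_ge0 _) h) _.
rewrite -expRD ler_expR.
have : - ln t * D%:R <= e / 2 * N%:R.
  apply: le_trans (ler_wpM2l L0 DN) _.
  have LL : 0 < 1 - ln t by rewrite ltr_wpDr.
  rewrite [leLHS](_ : _ = (- ln t / (1 - ln t)) * (e / 2 * N%:R)); last first.
    by field; rewrite gt_eqF.
  apply: ler_piMl; first by rewrite mulr_ge0// ltW// divr_gt0.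
  by rewrite ler_pdivrMr// mul1r lerDr.
have : t * N%:R <= e / 2 * N%:R by rewrite ler_wpM2r.
lra.
Qed.

(** [binsum_expR] serves twice. Since shattered sets are small, there are at most [2 ^ (d1 |Z|)] of
    them; hence at most [d1 |Z|] mistakes occur, and the possible sets of mistakes number at most
    [expR (e |Z|)]. *)
Lemma partial_labels_cover (R : realType) (e : R) : 0 < e ->
  exists2 d : R, 0 < d & forall (X : Type) (Z : finType)
      (label : X -> Z -> option bool),
    (forall J, shatters label (fun=> True) J -> #|J|%:R <= d * #|Z|%:R) ->
    exists2 s : seq {ffun Z -> bool}, (size s)%:R <= expR (e * #|Z|%:R) &
      forall x, exists2 f, f \in s &
        forall z b, label x z = Some b -> f z = b.
Proof.
move=> /binsum_expR[d1 d10 h1].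
have ln2 : 0 < ln 2 :> R by rewrite ln_gt0// ltr1n.
have /binsum_expR[d d0 h2] := mulr_gt0 d10 ln2.
exists d => // X Z label small.
pose sh := shattered label (fun=> True).
pose D := (\max_(J in sh) #|J|)%N.
have DN : D%:R <= d * #|Z|%:R.
  rewrite /D; elim/big_ind : _ => [|a b|J]; first by rewrite mulr_ge0// ltW.
    by rewrite /maxn; case: ifP.
  by rewrite inE => /asboolP; apply: small.
have shD : (#|sh| <= binsum #|Z| D.+1)%N.
  rewrite -card_small_sets; apply: subset_leq_card; apply/fintype.subsetP => J Jsh.
  by rewrite inE; apply: (@leq_bigmax_cond _ _ (fun A : {set Z} => #|A|%N)).
pose K := trunc_log 2 #|sh|.
have KZ : K%:R <= d1 * #|Z|%:R.
  have [sh0|sh0] := posnP #|sh|.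
    by rewrite /K sh0 trunc_log0 mulr_ge0// ltW.
  rewrite -(ler_pM2r ln2) -ler_expR mulrAC expRM_natl lnK ?posrE//.
  apply: le_trans (h2 _ _ DN); rewrite -natrX ler_nat.
  by apply: leq_trans shD; rewrite trunc_logP.
have [s sK scov] := @halving_cover X Z label (enum Z) (fun=> True) K.+1 (@trunc_log_ltn 2 _ isT).
exists s; first by apply: le_trans (h1 _ _ KZ); rewrite ler_nat cardE.
move=> x; have [f fs fx] := scov x I; exists f => // z b.
by apply: fx; rewrite mem_enum.
Qed.

Local Open Scope classical_set_scope.
Local Open Scope ring_scope.

(** * Folner sequences and independence *)

Definition fset_mul (G : groupType) (H F : {fset G}) : {fset G} :=
  [fset (h * x)%g | h in H, x in F]%fset.

Lemma card_fset_mul (G : groupType) (H F : {fset G}) k :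
  (forall h, h \in H -> #|` (ltranslate h F `\` F)%fset| <= k)%N ->
  (#|` fset_mul H F| <= #|` F| + #|` H| * k)%N.
Proof.
move=> Hk; pose U s := (\bigcup_(h <- s) (ltranslate h F `\` F))%fset.
have Us s : {subset s <= H} -> (#|` U s| <= size s * k)%N.
  rewrite /U; elim: s => [|h s IH] sH; first by rewrite big_nil cardfs0.
  rewrite big_cons (leq_trans (leq_card_fsetU _ _))//= mulSn leq_add//.
    by apply: Hk; apply: sH; rewrite mem_head.
  by apply: IH => x xs; apply: sH; rewrite in_cons xs orbT.
rewrite (@leq_trans #|` F `|` U (H : seq G)|%fset)//.
  apply: fsubset_leq_card; apply/fsubsetP => _ /imfset2P[h hH [x xF ->]].
  rewrite in_fsetU; have [//|hxF] := boolP ((h * x)%g \in F).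
  apply/bigfcupP; exists h; first by rewrite /= andbT.
  by rewrite in_fsetD hxF /=; apply/imfsetP; exists x.
by rewrite (leq_trans (leq_card_fsetU _ _))// leq_add2l Us.
Qed.

(** Eventually each of the [|H|] translates leaves [F n] in at most [|F n| / (|H| + 1)] points, so
    together they add at most [|F n|] points. *)
Lemma folner_fset_mul (R : realType) (G : groupType) (F : nat -> {fset G})
    (H : {fset G}) : folner_sequence R F ->
  \forall n \near \oo, (#|` fset_mul H (F n)| <= 2 * #|` F n|)%N.
Proof.
move=> [F0 FF].
have /(filter_bigI _) HF : forall h, h \in H -> \forall n \near \oo,
    (#|` H|.+1 * #|` fsymdiff (F n) (ltranslate h (F n))| <= #|` F n|)%N.
  move=> h _; have /(_ _ #|` H|.+1%:R^-1) := cvgr_lt _ (FF h).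
  rewrite invr_gt0 ltr0n => /(_ isT); apply: filterS => n /ltW.
  have Fn0 : 0 < #|` F n|%:R :> R by rewrite ltr0n cardfs_gt0.
  by rewrite ler_pdivrMr// mulrC ler_pdivlMr// mulrC -natrM ler_nat.
apply: filterS HF => n /= Hn.
pose k := (#|` F n| %/ #|` H|.+1)%N.
apply: leq_trans (card_fset_mul (k := k) _) _ => [h hH|].
  rewrite leq_divRL// mulnC; apply: leq_trans (Hn h hH).
  by rewrite leq_mul2l /= fsubset_leq_card// /fsymdiff fsubsetUr.
rewrite mul2n -addnn leq_add2l (leq_trans _ (leq_divM _ #|` H|.+1))//.
by rewrite mulnC leq_mul2l leqnSn orbT.
Qed.

Lemma generating_approx (R : realType) (G : groupType) (X : topologicalType)
    (act : G -> X -> X) (F : set (X -> R)) (psi : X -> R) (e : R) :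
  generating act F -> continuous psi -> 0 < e ->
  exists n (c : 'I_n -> R) (s : 'I_n -> X -> R) (h : 'I_n -> G),
    (forall i, F (s i)) /\
    forall x, `|psi x - \sum_(i < n) c i * s i (act (h i) x)| < e.
Proof.
move=> [_ Fd] psic e0.
have psiN : nbhs (psi : {uniform X -> R}) [set g | forall x, `|psi x - g x| < e].
  apply/uniform_nbhs; exists [set xy | ball xy.1 e xy.2]; split.
    exact: entourage_ball (PosNum e0).
  by move=> g /= gE x; apply: gE.
have [_ [[n [c [v [vF ->]]]] ve]] := Fd psi psic _ psiN.
have /choice[s sP] i : exists s, F s /\ exists h, s \o act h = v i.
  by have [s Fs [h _ <-]] := vF i; exists s; split => //; exists h.
have /choice[h hP] i : exists h, s i \o act h = v i by have [] := sP i.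
exists n, c, s, h; split=> [i|x]; first by have [] := sP i.
have := ve x; congr (`|_ - _| < _).
by rewrite fct_sumE; apply: eq_bigr => i _; rewrite -hP.
Qed.

(* The coefficients are indexed so that translating the approximated function
   by [a] translates the coefficients by [a]. *)
Lemma generating_approx_translates (R : realType) (G : groupType)
    (X : topologicalType) (act : G -> X -> X) (F : set (X -> R)) m
    (f : 'I_m -> X -> R) (psi : X -> R) (e : R) :
  {morph act : g h / (g * h)%g >-> g \o h} ->
  generating act F -> (forall s, F s -> exists j, f j = s) ->
  continuous psi -> 0 < e ->
  exists (H : {fset G}) (c : 'I_m -> G -> R),
    forall a (B : {fset G}), (forall h, h \in H -> (h * a)%g \in B) ->
    forall x, `|psi (act a x) - \sum_(p : 'I_m * B)
       c p.1 (val p.2 * a^-1)%g * f p.1 (act (val p.2) x)| < e.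
Proof.
move=> actM genF fF psic e0.
have [n [c [s [h [sF sc]]]]] := generating_approx genF psic e0.
have /choice[j jP] i : exists j, f j = s i by apply: fF.
exists [fset h i | i in 'I_n]%fset.
(* Several terms may share the same generator and the same translate, so their coefficients are
   added. *)
exists (fun j' h' => \sum_(i < n | (j i == j') && (h i == h')) c i).
move=> a B HB x.
have hB i : (h i * a)%g \in B by apply/HB/imfsetP; exists i.
have := sc (act a x); congr (`|_ - _| < _).
rewrite (partition_big (fun i => (j i, [` hB i]%fset)) predT)//=.
apply: eq_bigr => -[j' b] _ /=; rewrite big_distrl/=.
have E i : ((j i, [` hB i]%fset) == (j', b)) = (j i == j') && (h i == val b * a^-1)%g.
  rewrite xpair_eqE -(val_eqE [` hB i]%fset)/=; congr (_ && _).
  by apply/eqP/eqP => [<-|->]; rewrite ?mulgK ?mulgVK.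
apply: eq_big => [i|i]; first by rewrite E.
rewrite E => /andP[/eqP <- /eqP hi].
by rewrite jP -(mulgVK a (val b)) -hi actM.
Qed.

Lemma card_pairs_le (J : finType) (P : {set J * J}) :
  (forall p, p \in P -> p.1 != p.2) ->
  (#|P| <= 2 * #|[set ([set p.1; p.2]%SET : {set J}) | p in P]%SET|)%N.
Proof.
move=> Pne; pose g (p : J * J) := [set p.1; p.2]%SET.
rewrite mulnC -sum_nat_const -sum1_card (partition_big_imset g)/=.
apply: leq_sum => _ /imsetP[[a b] abP ->].
rewrite sum1dep_card.
apply: (@leq_trans #|[set (a, b); (b, a)]%SET|); last first.
  by rewrite cards2; case: (_ != _).
apply: subset_leq_card; apply/fintype.subsetP => -[c d].
rewrite !inE => /andP[cdP /eqP/setP cd].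
have := Pne _ cdP; have := cd c; have := cd d.
rewrite /g /= !inE !eqxx /= orbT !xpair_eqE => /esym/orP[]/eqP -> /esym/orP[]/eqP ->.
all: by rewrite !eqxx ?orbT.
Qed.

(** [J] is an independence set for the pair of disjoint sets [phi = 1] and [phi = -1]. *)
Definition independent_over (R : realType) (G : groupType) (X : Type)
    (act : G -> X -> X) (phi : X -> R) (J : {fset G}) :=
  forall S : {set J}, exists x, forall s : J,
    phi (act (val s) x) = (-1) ^+ (s \in S).

(** At points realising every sign pattern, the product of [phi] at two translates is the Walsh
    function of that pair. [approximate_rank_fin] bounds the unordered pairs, and passing to ordered
    ones doubles the bound. *)
Lemma independent_pairs_bound (R : realType) (G : groupType) (X : Type)
    (act : G -> X -> X) (phi : X -> R) m (f : 'I_m -> X -> R)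
    (J B : {fset G}) (P : {set J * J}) :
  independent_over act phi J ->
  (forall p, p \in P -> p.1 != p.2) ->
  (forall p, p \in P -> exists C : 'I_m * B -> R, forall x,
     `|phi (act (val p.1) x) * phi (act (val p.2) x)
       - \sum_q C q * f q.1 (act (val q.2) x)| <= 2^-1) ->
  (3 * #|P| <= 8 * (m * #|` B|))%N.
Proof.
move=> /choice[x phix] Pne PC.
pose E := [set ([set p.1; p.2]%SET : {set J}) | p in P]%SET.
pose T := {t | t \in E}.
pose A (q : 'I_m * B) (S : {set J}) := f q.1 (act (val q.2) (x S)).
have /choice[C wC] : forall t : T, exists C : 'I_m * B -> R, forall S,
    `|walsh R (val t) S - \sum_q C q * A q S| <= 2^-1.
  move=> [_ /= /imsetP[[a b] abP ->]]; have [C CP] := PC _ abP.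
  exists C => S /=; rewrite walsh2; last exact: Pne abP.
  by rewrite -!phix; apply: CP.
have := @approximate_rank_fin R T _ {set J} (fun t => walsh R (val t)) A C.
rewrite card_sig card_prod card_ord -cardfE.
have -> : #|[pred t | t \in E]| = #|E| by apply: eq_card.
have h0 : (0 < #|{: {set J}}|)%N by apply/card_gt0P; exists finset.set0.
move=> /(_ h0) h1; have h : (3 * #|E| <= 4 * (m * #|` B|))%N.
  by apply: h1 => // t t'; rewrite walsh_orthogonal val_eqE.
move: h (card_pairs_le Pne : #|P| <= 2 * #|E|)%N.
by move: #|P| #|E| #|` B| => p e b; nia.
Qed.

Lemma independent_small (R : realType) (G : groupType) (X : topologicalType)
    (act : G -> X -> X) (F : set (X -> R)) m (f : 'I_m -> X -> R)
    (Fn : nat -> {fset G}) (phi : X -> R) (d : R) :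
  infinite_set [set: G] -> continuous_action act -> generating act F ->
  (forall s, F s -> exists j, f j = s) -> continuous phi ->
  folner_sequence R Fn -> 0 < d ->
  \forall n \near \oo, forall J : {fset G}, (J `<=` Fn n)%fset ->
    independent_over act phi J -> #|` J|%:R <= d * #|` Fn n|%:R.
Proof.
move=> Ginf [_ actM actc] genF fF phic FnF d0.
have actM' : {morph act : g h / (g * h)%g >-> g \o h}.
  by move=> g h; apply/funext => x; exact: actM.
pose psi k x := phi x * phi (act k x).
have psic k : continuous (psi k).
  move=> x; apply: continuousM; first exact: phic.
  by apply: continuous_comp; [exact: actc|exact: phic].
have e0 : 0 < 2^-1 :> R by rewrite invr_gt0.
have /choice[H /choice[c Hc]] k :=
  generating_approx_translates actM' genF fF (psic k) e0.
(* Chosen so that [q * d > 3 * m + 1], which contradicts [h4] below when [J] has density above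
   [d]. *)
pose q := (Num.truncn ((3 * m + 1)%:R / d)).+1.
(* This size lets the error [q ^ 2 * |Y|], at most [2 * q ^ 2 * |Fn n|], be absorbed by
   [l * |Fn n|]. *)
have [L _ Ll] := infinite_set_fset (2 * q ^ 2).+1 Ginf.
set l := #|` L| in Ll.
pose K := [fset (u * v^-1)%g | u in L, v in L]%fset.
pose HK := (\bigcup_(k <- K) H k)%fset.
pose L' := [fset u^-1%g | u in L]%fset.
have := folner_fset_mul HK FnF; have := folner_fset_mul L' FnF.
apply: filterS2 => n YF BF J JFn Jind.
rewrite leNgt; apply/negP => dJ.
pose Y := fset_mul L' (Fn n); pose B := fset_mul HK (Fn n).
(* [a] is joined to [y] when it lies in the translate [L y]. Its neighbours are the [l] elements
   [u^-1 a] with [u] in [L]. *)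
pose r (a : J) (y : Y) := (val a * (val y)^-1)%g \in L.
have rl a : #|[set y | r a y]%SET| = l.
  have uY (u : L) : ((val u)^-1 * val a)%g \in Y.
    apply/imfset2P; exists (val u)^-1%g.
      by apply/imfsetP; exists (val u) => //; apply: valP.
    by exists (val a) => //; apply: (fsubsetP JFn); apply: valP.
  pose g (u : L) : Y := [` uY u]%fset.
  have gI : injective g.
    by move=> u v /(congr1 val)/= /mulIg /invg_inj /val_inj.
  rewrite /l cardfE -(card_imset _ gI); apply: eq_card => y; rewrite !inE.
  apply/idP/imsetP => [yL|[u _ ->]]; last first.
    by rewrite /r /= invgM invgK mulgA mulgV mul1g; apply: valP.
  by exists [` yL]%fset => //; apply: val_inj; rewrite /= invgF mulgVK.
have := card_common_neighbour_pairs q rl.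
set P := common_neighbour_pairs r.
have : (3 * #|P| <= 8 * (m * #|` B|))%N.
  apply: (independent_pairs_bound (f := f) Jind) => [p|[a b]].
    by rewrite inE => /andP[].
  rewrite inE /= => /andP[_ /existsP[y /andP[ay by_]]].
  (* As [a] and [b] lie in the same [L y], [k] is in [L L^-1], and the product of [phi] at [a x] and
     [b x] is [psi k] at [a x]. *)
  pose k := (val b * (val a)^-1)%g.
  have kK : k \in K.
    apply/imfset2P; exists (val b * (val y)^-1)%g => //.
    exists (val a * (val y)^-1)%g => //.
    by rewrite mulgKA.
  exists (fun p => c k p.1 (val p.2 * (val a)^-1)%g) => x; apply/ltW.
  have := Hc k (val a) B _ x; rewrite /psi -actM /k mulgVK; apply.
  move=> h hH; apply/imfset2P; exists h.
    by apply/bigfcupP; exists k; rewrite ?andbT.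
  by exists (val a) => //; apply: (fsubsetP JFn); apply: valP.
rewrite -!cardfE => h1 h2.
have JF : (#|` J| <= #|` Fn n|)%N by exact: fsubset_leq_card.
have qd : (3 * m + 1)%:R < q%:R * d.
  by rewrite -ltr_pdivrMr// truncnS_gt.
have h3 : (2 * q * #|` J| <= #|` J| + #|P| + #|` Fn n|)%N.
  have l0 : (0 < l)%N by apply: leq_trans Ll.
  rewrite -(leq_pmul2l l0); apply: (@leq_trans (2 * q * (l * #|` J|))).
    by rewrite mulnCA.
  apply: leq_trans h2 _; rewrite !mulnDr leq_add2l.
  apply: (@leq_trans (q ^ 2 * (2 * #|` Fn n|))); first by rewrite leq_mul2l YF orbT.
  by rewrite mulnA [(_ * 2)%N]mulnC leq_mul2r (ltnW Ll) orbT.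
(* In [h3], [|J|] is at most [|Fn n|] and [|P|] at most [6 * m * |Fn n|]; then halve. *)
have h4 : (q * #|` J| <= (3 * m + 1) * #|` Fn n|)%N.
  have : (#|P| <= 6 * (m * #|` Fn n|))%N.
    have : (m * #|` B| <= 2 * (m * #|` Fn n|))%N by rewrite mulnCA leq_mul2l BF orbT.
    by lia.
  rewrite mulnDl mul1n -mulnA; move: h3; rewrite -mulnA.
  by lia.
move: h4; rewrite -(ler_nat R) !natrM leNgt => /negP; apply.
have Fn0 : 0 < #|` Fn n|%:R :> R by rewrite ltr0n cardfs_gt0 (FnF.1 n).
rewrite -(ltr_pM2r Fn0) in qd; apply: lt_trans qd _.
by rewrite -mulrA ltr_pM2l// ltr0n.
Qed.

(** * Entropy *)

Lemma mdist_continuous (R : realType) (X : metricType R) (y : X) :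
  continuous (mdist y : X -> R).
Proof.
move=> x; apply/cvgrPdist_lt => e e0.
have /filterS : nbhs x (ball x e) by exact: nbhsx_ballx.
apply=> z; rewrite ballEmdist /= => xz.
have := metric_triangle y x z; have := metric_triangle y z x.
by rewrite (metric_sym z x) ltr_norml; lra.
Qed.

(** The affine function of the distance to [y] with value 1 at [r] and -1 at [2 * r], truncated to
    [[-1, 1]]. *)
Definition bump (R : realType) (X : metricType R) (y : X) (r : R) (x : X) : R :=
  Num.max (-1) (Num.min 1 (3 - 2 / r * mdist y x)).

Section Bump.
Variables (R : realType) (X : metricType R) (y : X) (r : R).
Hypothesis r0 : 0 < r.

Lemma bump_continuous : continuous (bump y r).
Proof.
move=> x; pose g z := 3 - 2 / r * mdist y z.
apply: (@continuous_max R X (cst (-1)) (cst 1 \min g)); first exact: cvg_cst.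
apply: (@continuous_min R X (cst 1) g); first exact: cvg_cst.
apply: cvgB; first exact: cvg_cst.
by apply: cvgMr; exact: mdist_continuous.
Qed.

Lemma bump_near x : mdist y x <= r -> bump y r x = 1.
Proof.
move=> yx; rewrite /bump; have h : 2 / r * mdist y x <= 2.
  by rewrite mulrAC ler_pdivrMr// ler_pM2l.
by rewrite min_l ?max_r//; lra.
Qed.

Lemma bump_far x : 2 * r <= mdist y x -> bump y r x = -1.
Proof.
move=> yx; rewrite /bump; have h : 4 <= 2 / r * mdist y x.
  by rewrite mulrAC ler_pdivlMr//; lra.
by rewrite min_r ?max_l//; lra.
Qed.

End Bump.

Lemma compact_setT_cover (X : topologicalType) :
  compact [set: X] -> cover_compact [set: X].
Proof.
move=> Xc; have [[x0 _]|X0] := pselect (exists x : X, True); last first.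
  by move=> I D f _ _; exists fset0 => // x; case: X0; exists x.
pose PX : ptopologicalType := HB.pack X (isPointed.Build X x0).
by suff: @cover_compact PX [set: X] by []; rewrite -compact_cover.
Qed.

(** Each point is the centre of a ball whose double lies in a member of [A]. Finitely many of these
    balls cover, and their bumps are taken. *)
Lemma cover_bumps (R : realType) (X : metricType R) (A : set (set X)) :
  compact [set: X] -> finite_open_cover A ->
  exists (I : finType) (phi : I -> X -> R) (U : I -> set X),
    [/\ forall i, continuous (phi i), forall i, A (U i),
        forall x, exists i, phi i x = 1 &
        forall i x, phi i x <> -1 -> U i x].
Proof.
move=> Xc [_ Aopen Acov].
have /choice[V Vy] y : exists V, A V /\ exists2 r : R, 0 < r &
    forall x, mdist y x < 2 * r -> V x.
  have : [set: X] y by []; rewrite -Acov => -[V AV Vy]; exists V; split => //.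
  have /nbhs_ballP[r /= r0 rV] : nbhs y V by apply: open_nbhs_nbhs; split=> //; exact: Aopen.
  exists (r / 2); first exact: divr_gt0.
  by move=> x yx; apply: rV; rewrite ballEmdist /=; move: yx; lra.
have /choice[r rP] y : exists r : R, 0 < r /\
    forall x, mdist y x < 2 * r -> V y x by have [_ [r]] := Vy y; exists r.
move: (compact_setT_cover Xc (I := X) (D := setT) (f := fun y => (ball y (r y))^°)).
case=> [y _|x _|D _ Dcov]; first exact: open_interior.
  by exists x => //; apply: nbhsx_ballx; have [] := rP x.
exists D, (fun i => bump (val i) (r (val i))), (fun i => V (val i)).
split=> [i|i|x|i x].
- by apply: bump_continuous; have [] := rP (val i).
- by have [] := Vy (val i).
- have [y /= yD] := Dcov x I.
  move=> /interior_subset; rewrite ballEmdist => yx.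
  by exists [` yD]%fset; rewrite bump_near ?ltW//; have [] := rP y.
- move=> far; have [ri riV] := rP (val i); apply: riV.
  by rewrite ltNge; apply/negP => /(bump_far ri).
Qed.

Lemma min_subcover_le (R : realType) (X : Type) (C : set (set X)) (T : choiceType)
    (s : seq T) (W : T -> set X) :
  (forall t, t \in s -> C (W t)) -> (forall x, exists2 t, t \in s & W t x) ->
  min_subcover R C <= (size s)%:R.
Proof.
move=> CW Wcov; pose B := [fset w in map W s]%fset.
apply: (@le_trans _ _ #|` B|%:R).
  apply: ge_inf; first by exists 0 => _ [n _ <-].
  exists #|` B| => //; exists [set` B]; split; last exact/card_eq_fsetP.
    by move=> w /=; rewrite inE => /mapP[t ts ->]; exact: CW.
  apply/seteqP; split => // x _; have [t ts Wx] := Wcov x.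
  by exists (W t) => //=; rewrite inE map_f.
by rewrite ler_nat card_fseq (leq_trans (size_undup _))// size_map.
Qed.

Lemma ln_min_subcover_bounds (R : realType) (X : Type) (C : set (set X)) (b : R) :
  0 <= b ->  min_subcover R C <= expR b -> 0 <= ln (min_subcover R C) <= b.
Proof.
(* [ln] is 0 by default at nonpositive arguments. A positive infimum excludes subcovers of size 0,
   so it is at least 1. *)
move=> b0 Cb; have [C0|C0] := leP (min_subcover R C) 0; first by rewrite ln0// lexx.
rewrite -[X in _ && (_ <= X)]expRK ler_ln ?posrE ?expR_gt0// Cb andbT ln_ge0//.
have Cn : [set (n%:R : R) | n in [set n : nat | exists B : set (set X),
    [/\ B `<=` C, covers B & (B #= `I_n)%card]]] !=set0.
  apply/set0P; apply: contraTN C0 => /eqP Cn; rewrite /min_subcover Cn inf0.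
  by rewrite ltxx.
apply: lb_le_inf => // _ [n [B [BC Bc Bn]] <-].
case: n Bn => [|n] Bn; last by rewrite ler1n.
have B0 : B = set0 by move: Bn; rewrite II0 card_eq0 => /eqP.
move: C0; rewrite ltNge => /negP[]; apply: ge_inf; first by exists 0 => _ [k _ <-].
by exists 0%N => //; exists B.
Qed.

Section BumpLabels.
Variables (R : realType) (G : groupType) (X : Type) (act : G -> X -> X).
Variables (I : finType) (phi : I -> X -> R) (F : {fset G}).

(** Values other than 1 and -1 get no label, and so put no constraint on a labelling. The Boolean is
    the exponent of -1, as in [independent_over]. *)
Definition bump_label (x : X) (z : I * F) : option bool :=
  let v := phi z.1 (act (val z.2) x) in
  if v == 1 then Some false else if v == -1 then Some true else None.

Lemma bump_labelP x z b :
  bump_label x z = Some b <-> phi z.1 (act (val z.2) x) = (-1) ^+ b.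
Proof.
have N11 : (-1 : R) == 1 = false by apply/negbTE; rewrite lt_eqF// gtrN.
rewrite /bump_label; split.
  by case: eqP => [->|_]; [|case: eqP => // ->]; case: b.
by move=> ->; case: b; rewrite ?expr1 ?expr0 ?eqxx ?N11.
Qed.

Definition section_fset (J : {set I * F}) (i : I) : {fset G} :=
  [fset val s | s in [set s : F | (i, s) \in J]%SET]%fset.

Lemma section_fset_sub J i : (section_fset J i `<=` F)%fset.
Proof. by apply/fsubsetP => _ /imfsetP[s _ ->]; apply: valP. Qed.

Lemma card_section_fset (J : {set I * F}) : (#|J| = \sum_i #|` section_fset J i|)%N.
Proof.
rewrite -sum1_card (eq_bigl (fun p => ((p.1, p.2) \in J))); last by case.
rewrite -(pair_big_dep predT (fun i s => (i, s) \in J) (fun _ _ => 1%N))/=.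
apply: eq_bigr => i _; rewrite sum1dep_card card_imfset/=; last exact: val_inj.
by rewrite -cardE.
Qed.

Lemma shatters_independent J i :
  shatters bump_label (fun=> True) J ->
  independent_over act (phi i) (section_fset J i).
Proof.
move=> Jsh S.
pose S' := [set z : I * F | [exists s, (s \in S) && (val s == val z.2)]]%SET.
have [x _ xS] := Jsh S'; exists x => s.
have /imfsetP[/= t + st] := valP s; rewrite inE => tJ.
have /bump_labelP /= := xS _ tJ; rewrite -st => ->; congr (_ ^+ nat_of_bool _).
rewrite inE; apply/existsP/idP => /= [[s' /andP[s'S]]|sS].
  by rewrite -st => /eqP /val_inj <-.
by exists s; rewrite sS st /=.
Qed.

(** A labelling [f] selects, at each [g], an index [i] not labelled -1. If [f] agrees with the
    labels of [x], then [phi i] is not -1 at [g x], so [g x] is in [U i]. Such an [i] exists since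
    some bump equals 1 there. *)
Lemma join_cover_labels (A : set (set X)) (U : I -> set X)
    (s : seq {ffun I * F -> bool}) :
  (forall i, A (U i)) -> (forall x, exists i, phi i x = 1) ->
  (forall i x, phi i x <> -1 -> U i x) ->
  (forall x, exists2 f, f \in s &
     forall z b, bump_label x z = Some b -> f z = b) ->
  min_subcover R (join_cover act F A) <= (size s)%:R.
Proof.
move=> AU phi1 phiU scov.
(* An empty space may leave [I] without a default index, but then the empty family covers. *)
have [[x0 _]|X0] := pselect (exists x : X, True); last first.
  apply: (@le_trans _ _ 0); last exact: ler0n.
  apply: (@min_subcover_le _ _ _ nat [::] (fun=> set0)) => // x.
  by case: X0; exists x.
have [i0 _] := phi1 x0.
pose pick_member (f : {ffun I * F -> bool}) (g : F) : I :=
  odflt i0 [pick i | ~~ f (i, g)].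
pose W f := \bigcap_(g in [set` F])
  (act g @^-1` U (if insub g is Some g' then pick_member f g' else i0)).
apply: (@min_subcover_le _ _ _ _ s W) => [f fs|x].
  by exists (fun g => U (if insub g is Some g' then pick_member f g' else i0)).
have [f fs fx] := scov x; exists f => // g /= gF.
rewrite insubT /= /pick_member; apply: phiU => phiN.
move: phiN; case: pickP => [i fi|f0] phiN.
  move/negP: fi; apply; apply: fx; exact/bump_labelP.
have [i phii] := phi1 (act g x).
by have := f0 i; rewrite (fx (i, Sub g gF) false)//; exact/bump_labelP.
Qed.

End BumpLabels.

Lemma cover_entropy_rate (R : realType) (G : groupType) (X : metricType R)
    (act : G -> X -> X) (F : set (X -> R)) m (f : 'I_m -> X -> R)
    (Fn : nat -> {fset G}) (A : set (set X)) :
  infinite_set [set: G] -> compact [set: X] -> continuous_action act ->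
  generating act F -> (forall s, F s -> exists j, f j = s) ->
  folner_sequence R Fn -> finite_open_cover A ->
  ln (min_subcover R (join_cover act (Fn n) A)) / #|` Fn n|%:R
    @[n --> \oo] --> (0 : R).
Proof.
move=> Ginf Xc actc genF fF FnF Acov.
have [I [phi [U [phic AU phi1 phiU]]]] := cover_bumps Xc Acov.
apply/cvgr0Pnorm_le => e e0.
(* There are [|I|] labels per element of [Fn n]; the successor covers an empty [I]. *)
have e'0 : 0 < e / #|I|.+1%:R by rewrite divr_gt0.
have [d d0 dP] := partial_labels_cover e'0.
have /filter_forall small : forall i, \forall n \near \oo, forall J : {fset G},
    (J `<=` Fn n)%fset -> independent_over act (phi i) J ->
    #|` J|%:R <= d * #|` Fn n|%:R.
  by move=> i; exact: (independent_small Ginf actc genF fF (phic i) FnF d0).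
apply: filterS small => n small.
have cardZ : #|{: I * Fn n}| = (#|I| * #|` Fn n|)%N by rewrite card_prod -cardfE.
have [J Jsh|s sb scov] := dP X (I * Fn n)%type (@bump_label _ _ _ act _ phi (Fn n)).
  (* Each fibre of a shattered set over [I] is independent, hence of density at most [d]. *)
  rewrite card_section_fset natr_sum cardZ natrM mulrCA mulr_natl -sumr_const.
  apply: ler_sum => i _; apply: small.
    exact: section_fset_sub.
  exact: shatters_independent.
have Nb := le_trans (join_cover_labels AU phi1 phiU scov) sb.
have b0 : 0 <= e / #|I|.+1%:R * #|{: I * Fn n}|%:R by rewrite mulr_ge0// ltW.
have /andP[ln0 lnb] := ln_min_subcover_bounds b0 Nb.
have Fn0 : 0 < #|` Fn n|%:R :> R by rewrite ltr0n cardfs_gt0 (FnF.1 n).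
rewrite ger0_norm ?divr_ge0// ler_pdivrMr//; apply: le_trans lnb _.
rewrite cardZ natrM mulrA ler_pM2r// mulrAC ler_pdivrMr// ler_pM2l// ler_nat.
exact: leqnSn.
Qed.

Theorem mainTheorem2 (R : realType) (G : groupType) (X : metricType R)
    (act : G -> X -> X)
    (G_countably_infinite : ([set: G] #= [set: nat])%card)
    (G_amenable : amenable R G)
    (X_compact : compact [set: X])
    (act_continuous : continuous_action act)
    (mult_finite : (topological_multiplicity R act < +oo)%E) :
  topological_entropy R act = 0%E.
Proof.
have Ginf : infinite_set [set: G].
  by rewrite (eq_finite_set G_countably_infinite); exact: infinite_nat.
have [m [F genF Fm]] : exists m, exists2 F : set (X -> R),
    generating act F & (F #= `I_m)%card.
  apply: contrapT => noF; move: mult_finite.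
  rewrite /topological_multiplicity (_ : [set _ | _ in _] = set0) ?ereal_inf0//.
  by rewrite -subset0 => y [m mP _]; apply: noF; exists m.
have [f fF] : exists f : 'I_m -> X -> R, forall s, F s -> exists j, f j = s.
  move: Fm; rewrite card_eq_sym => /card_set_bijP[f [_ _ fs]].
  exists (fun j => f (val j)) => s /fs[j jm <-]; by exists (Ordinal jm).
have cover0 A : finite_open_cover A -> cover_entropy R act A = 0%E.
  (* 0 is a common limit. Amenability provides a Folner sequence, which makes the common limit
     unique. *)
  move=> Acov; apply: xget_subset1 => [Fn FnF|l l' lP l'P].
    apply: cvg_EFin; first exact: nearW.
    exact: cover_entropy_rate genF fF FnF Acov.
  have [Fn FnF] := G_amenable.
  exact: cvg_unique (lP _ FnF) (l'P _ FnF).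
rewrite /topological_entropy (_ : [set _ | _ in _] = [set 0%E]) ?ereal_sup1//.
apply/seteqP; split => [_ [A Acov <-]|_ ->]; first exact: cover0.
(* The trivial cover shows that the supremum is not over an empty set. *)
exists [set [set: X]]; last first.
  apply: cover0; split=> [|_ ->|]; [exact: finite_set1|exact: openT|].
  by rewrite /covers bigcup_set1.
split=> [|_ ->|]; [exact: finite_set1|exact: openT|].
by rewrite /covers bigcup_set1.
Qed.
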